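(* Let $a,b,t$ be complex numbers, let $f_3(z,a,b)$ be the unique formal power series with $f_3=1+azf_3+bz^3f_3^2$, define $C(n,3,a,b,t)$ by $\sum_{n\ge0}C(n,3,a,b,t)z^n=\frac{f_3}{1-tzf_3}$, and let $D_2^{(3)}(N,a,b,t)=\det\big(C(i+j+2,3,a,b,t)\big)_{i,j=0}^{N-1}$. Then $$D_2^{(3)}(3n,a,b,t)=(-1)^{n+1}b^{3n^2+n-1}\Big(a^3\sum_{i=0}^ni^2-(n+1)b+nat\big(t+(n+1)a\big)\Big)\quad(n\ge0),$$ $$D_2^{(3)}(3n+1,a,b,t)=(-1)^n\big(t+(n+1)a\big)^2b^{3n^2+3n}\quad(n\ge0),$$ $$D_2^{(3)}(3n-1,a,b,t)=(-1)^{n-1}b^{3n^2-n-1}\Big(a^3\sum_{i=0}^ni^2-nb+nat\big(t+(n+1)a\big)\Big)\quad(n\ge1).$$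
   Context: The determinant of a $0\times0$ matrix is $1$. *)

(* Defs.v *)
From HB Require Import structures.
From mathcomp Require Import all_boot all_order all_algebra.
From mathcomp Require Import boolp reals.
From mathcomp Require Import complex.

Set Implicit Arguments.
Unset Strict Implicit.
Unset Printing Implicit Defensive.

Import GRing.Theory.
Local Open Scope ring_scope.

(* [Fps u] is the formal power series [\sum_n u n z^n], and [f n] is the
   coefficient of [z^n] in [f]. *)
Record fps (R : Type) := Fps { fps_coef :> nat -> R }.

Lemma fpsP (R : Type) (f g : fps R) : (forall n, f n = g n) -> f = g.
Proof. by case: f g => [u] [v] /= uv; congr Fps; apply: funext. Qed.

HB.instance Definition _ (R : Type) := gen_eqMixin (fps R).
HB.instance Definition _ (R : Type) := gen_choiceMixin (fps R).

Section FpsZmod.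
Variable R : zmodType.
Implicit Types f g h : fps R.

Definition fps_zero : fps R := Fps (fun=> 0).
Definition fps_opp f : fps R := Fps (fun n => - f n).
Definition fps_add f g : fps R := Fps (fun n => f n + g n).

Lemma fps_addA : associative fps_add.
Proof. by move=> f g h; apply: fpsP => n /=; rewrite addrA. Qed.
Lemma fps_addC : commutative fps_add.
Proof. by move=> f g; apply: fpsP => n /=; rewrite addrC. Qed.
Lemma fps_add0 : left_id fps_zero fps_add.
Proof. by move=> f; apply: fpsP => n /=; rewrite add0r. Qed.
Lemma fps_addN : left_inverse fps_zero fps_opp fps_add.
Proof. by move=> f; apply: fpsP => n /=; rewrite addNr. Qed.

HB.instance Definition _ :=
  GRing.isZmodule.Build (fps R) fps_addA fps_addC fps_add0 fps_addN.

End FpsZmod.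

Section FpsRing.
Variable R : comNzRingType.
Implicit Types f g h : fps R.

Definition fpsC (c : R) : fps R := Fps (fun n => if n == 0%N then c else 0).
Definition fpsX : fps R := Fps (fun n => (n == 1%N)%:R).
Definition fps_mul f g : fps R :=
  Fps (fun n => \sum_(k < n.+1) f k * g (n - k)%N).

Definition fps_trunc n f : {poly R} := \poly_(i < n) f i.

Lemma coef_fps_trunc n f i : (i < n)%N -> (fps_trunc n f)`_i = f i.
Proof. by rewrite coef_poly => ->. Qed.

Lemma fps_mul_trunc m n f g : (n < m)%N ->
  fps_mul f g n = (fps_trunc m f * fps_trunc m g)`_n.
Proof.
move=> nm; rewrite coefM /=; apply: eq_bigr => k _.
rewrite !coef_fps_trunc //; first exact: leq_ltn_trans (leq_subr _ _) nm.
by apply: leq_trans nm; exact: ltn_ord.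
Qed.

Lemma fps_mulC : commutative fps_mul.
Proof.
by move=> f g; apply: fpsP => n; rewrite !(fps_mul_trunc _ _ (ltnSn n)) mulrC.
Qed.

Lemma fps_mulA : associative fps_mul.
Proof.
move=> f g h; apply: fpsP => n.
transitivity ((fps_trunc n.+1 f * fps_trunc n.+1 g * fps_trunc n.+1 h)`_n).
  rewrite -mulrA coefM; apply: eq_bigr => k _.
  rewrite coef_fps_trunc // (@fps_mul_trunc n.+1) //.
  by rewrite ltnS leq_subr.
rewrite coefM; apply: eq_bigr => k _.
rewrite (@fps_mul_trunc n.+1) // coef_fps_trunc //.
by rewrite ltnS leq_subr.
Qed.

Lemma fps_mul1 : left_id (fpsC 1) fps_mul.
Proof.
move=> f; apply: fpsP => n /=.
rewrite big_ord_recl /= mul1r subn0 big1 ?addr0 // => i _.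
by rewrite mul0r.
Qed.

Lemma fps_mulDl : left_distributive fps_mul +%R.
Proof.
move=> f g h; apply: fpsP => n /=; rewrite -big_split /=.
by apply: eq_bigr => k _; rewrite mulrDl.
Qed.

Lemma fps1_neq0 : fpsC 1 != 0.
Proof.
apply/eqP => /(congr1 (fun f : fps R => f 0%N)) /= /eqP.
by rewrite oner_eq0.
Qed.

HB.instance Definition _ := GRing.Zmodule_isComNzRing.Build (fps R)
  fps_mulA fps_mulC fps_mul1 fps_mulDl fps1_neq0.

End FpsRing.

Arguments fpsX {R}.

Section FpsUnit.
Variable R : comUnitRingType.
Implicit Types f g : fps R.

(* The first [n] coefficients of [f^-1], by the usual recursion
   [g_m = f_0^-1 ([m = 0] - \sum_(i < m) f_(m-i) g_i)]. *)
Fixpoint fps_inv_prefix f n : seq R :=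
  if n is m.+1 then
    let s := fps_inv_prefix f m in
    rcons s ((f 0%N)^-1 * ((m == 0%N)%:R - \sum_(i < m) f (m - i)%N * s`_i))
  else [::].

Definition fps_unit : pred (fps R) := fun f => f 0%N \is a GRing.unit.

Definition fps_inv f : fps R :=
  if fps_unit f then Fps (fun n => (fps_inv_prefix f n.+1)`_n) else f.

Lemma size_fps_inv_prefix f n : size (fps_inv_prefix f n) = n.
Proof. by elim: n => //= n IH; rewrite size_rcons IH. Qed.

Lemma fps_inv_prefixE f n i : (i < n)%N ->
  (fps_inv_prefix f n)`_i = (fps_inv_prefix f i.+1)`_i.
Proof.
elim: n => // n IH; rewrite ltnS leq_eqVlt => /predU1P [-> //|lt_in].
by rewrite -IH //= nth_rcons size_fps_inv_prefix lt_in.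
Qed.

Lemma fps_mulV : {in fps_unit, left_inverse 1 fps_inv *%R}.
Proof.
move=> f; rewrite unfold_in => Uf; apply: fpsP => n.
rewrite /fps_inv /fps_unit ifT // -[LHS]/(\sum_(k < n.+1) _) big_ord_recr /= subnn.
rewrite nth_rcons size_fps_inv_prefix ltnn eqxx mulrAC mulVr // mul1r.
under eq_bigr => k _.
  rewrite -/(fps_inv_prefix f k.+1) mulrC -(@fps_inv_prefixE _ n) //; over.
by rewrite addrC subrK; case: eqP.
Qed.

Lemma fps_unitPl f g : g * f = 1 -> fps_unit f.
Proof.
move=> /(congr1 (fun h : fps R => h 0%N)).
rewrite -[LHS]/(\sum_(k < 1) _) big_ord1 subnn -[RHS]/(1 : R) => gf1.
by apply/unitrP; exists (g 0%N); split=> //; rewrite mulrC.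
Qed.

Lemma fps_inv_out : {in [predC fps_unit], fps_inv =1 id}.
Proof. by move=> f /negPf nUf; rewrite /fps_inv ifF. Qed.

HB.instance Definition _ := GRing.ComNzRing_hasMulInverse.Build (fps R)
  fps_mulV fps_unitPl fps_inv_out.

End FpsUnit.

Section F3.
Variable R : comNzRingType.
Implicit Types f g : fps R.

Let agree n f g := forall i, (i < n)%N -> f i = g i.

Let agree_mul n f g f' g' : agree n f f' -> agree n g g' ->
  agree n (f * g) (f' * g').
Proof.
move=> ff gg i lt_in; apply: eq_bigr => k _; rewrite ff ?gg //.
  exact: leq_ltn_trans (leq_subr _ _) lt_in.
exact: leq_trans (ltn_ord k) lt_in.
Qed.

Let agree_mulX n f g : agree n f g -> agree n.+1 (fpsX * f) (fpsX * g).
Proof.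
move=> fg i le_in; rewrite -![LHS]/(\sum_(k < i.+1) _).
rewrite -[RHS]/(\sum_(k < i.+1) _) !big_ord_recl /= !mul0r; congr (_ + _).
apply: eq_bigr => k _; congr (_ * _); apply: fg; rewrite /= /bump /= add1n.
have := ltn_ord k; case: i le_in k => [|i] le_in k //= _.
by rewrite subSS; apply: leq_ltn_trans (leq_subr _ _) _; rewrite -ltnS.
Qed.

Let agreeW m n f g : (m <= n)%N -> agree n f g -> agree m f g.
Proof. by move=> mn fg i im; apply: fg; apply: leq_trans mn. Qed.

Lemma f3_exists_unique (a b : R) :
  exists! f : fps R, f = 1 + fpsC a * fpsX * f + fpsC b * fpsX ^+ 3 * f ^+ 2.
Proof.
pose F f := 1 + fpsC a * fpsX * f + fpsC b * fpsX ^+ 3 * f ^+ 2.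
have Fcontr n f g : agree n f g -> agree n.+1 (F f) (F g).
  move=> fg i le_in; rewrite /F (exprS fpsX 2) -!mulrA.
  congr (_ + _ + _).
    by apply: (@agree_mul n.+1) le_in => //; apply: agree_mulX.
  apply: (@agree_mul n.+1) le_in => //; apply: agree_mulX.
  apply: agree_mul => //; apply: agree_mul => //; exact: agree_mul.
pose s n := iter n F 0.
have sS n : agree n (s n) (s n.+1).
  by elim: n => [|n IH] //; apply: Fcontr.
have sD n m : agree n (s n) (s (m + n)%N).
  elim: m => [|m IH] // i lt_in; rewrite IH // sS //.
  exact: leq_trans lt_in (leq_addl _ _).
pose f := Fps (fun n => s n.+1 n).
have fs n : agree n f (s n).
  by move=> i lt_in; rewrite -[LHS]/(s i.+1 i) (sD i.+1 (n - i.+1)%N) // subnK.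
exists f; split.
  apply: fpsP => n; have /(_ n (ltnSn n)) := Fcontr _ _ _ (fs n).
  by rewrite -/(F f) => ->.
move=> g gE; apply: fpsP => n.
have: agree n.+1 (s n.+1) g.
  elim: n.+1 => [|m IH] // i im; rewrite [g]gE; exact: Fcontr im.
exact.
Qed.

End F3.

Definition D2 (R : comNzRingType) (c : nat -> R) (N : nat) : R :=
  \det (\matrix_(i < N, j < N) c (i + j + 2)%N).

(* Main.v *)
Require Import Defs.
From HB Require Import structures.
From mathcomp Require Import all_boot all_order all_algebra.
From mathcomp Require Import boolp reals.
From mathcomp Require Import complex.
From mathcomp Require Import ring zify.
Set Implicit Arguments.
Unset Strict Implicit.
Unset Printing Implicit Defensive.
Import GRing.Theory.
Local Open Scope ring_scope.

(* With [F = f / (1 - t z f)] one has [F = 1 / (1 - (a + t) z - b z^3 f)] and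
   [f = 1 / (1 - a z - b z^3 f)].  In [x = 1 / z] this is a continued fraction
   with partial denominators [x - (a + t), x^2 - a x, x - a, x^2 - a x, ...], so
   the moment functional [x^n |-> C n] has orthogonal polynomials exactly in
   degrees [3 n] and [3 n + 1], whose moment series are [F (b^2 z^3 f^2)^n] and
   [b z^2 f F (b^2 z^3 f^2)^n].  These give the unshifted Hankel determinants.
   [D2 C N] is the upper left cofactor of the unshifted Hankel matrix of size
   [N + 1]; by Cramer's rule it is read off the constant coefficient of the
   reproducing kernel at [0], which accumulates [a (t + k a)^2] at every period,
   or, for [N = 3 n + 1], off a vector of the kernel of that matrix.  The
   division by [b] in the kernel argument excludes [b = 0], where the moments
   are geometric. *)

(** * Cofactors from linear relations between columns *)

Section Cofactors.
Variable R : comNzRingType.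

(** Cramer's rule without division, by multiplying with [\adj A]. *)
Lemma det_mul_coord n (A : 'M[R]_n) (v : 'cV_n) c i j :
  A *m v = c *: delta_mx i 0 -> \det A * v j 0 = c * cofactor A i j.
Proof.
move=> Av; have := congr1 (mulmx (\adj A)) Av.
rewrite mulmxA mul_adj_mx mul_scalar_mx => /matrixP/(_ j 0).
rewrite mxE => ->; rewrite -scalemxAr mxE; congr (_ * _).
rewrite mxE (bigD1 i) //= !mxE !eqxx mulr1 big1 ?addr0 // => k ki.
by rewrite !mxE (negPf ki) mulr0.
Qed.

(** Row [i] is replaced by the [j]-th unit row: the new determinant is [cofactor A i j], and [v] is
    sent to [v j 0] times the [i]-th unit vector, so [det_mul_coord] applies. *)
Lemma cofactor_ker n (A : 'M[R]_n) (v : 'cV_n) i j k :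
  A *m v = 0 -> cofactor A i j * v k 0 = cofactor A i k * v j 0.
Proof.
move=> Av.
pose B := \matrix_(i', j') if i' == i then (j' == j)%:R else A i' j'.
have cofB l : cofactor B i l = cofactor A i l.
  congr (_ * \det _); apply/matrixP => x y; rewrite !mxE.
  by rewrite eq_sym (negPf (neq_lift _ _)).
have detB : \det B = cofactor A i j.
  rewrite (expand_det_row _ i) (bigD1 j) //= cofB mxE !eqxx mul1r.
  by rewrite big1 ?addr0 // => l lj; rewrite mxE eqxx (negPf lj) mul0r.
rewrite -detB -[cofactor A i k]cofB [RHS]mulrC; apply: det_mul_coord.
apply/matrixP => x y; rewrite ord1 !mxE eqxx andbT.
have [->|xi] := eqVneq x i.
  rewrite mulr1 (bigD1 j) //= mxE !eqxx mul1r.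
  by rewrite big1 ?addr0 // => l lj; rewrite mxE eqxx (negPf lj) mul0r.
have /matrixP/(_ x 0) := Av; rewrite !mxE mulr0 => {2}<-.
by apply: eq_bigr => l _; rewrite mxE (negPf xi).
Qed.

End Cofactors.

(** * Hankel determinants and moment functionals *)

Section Hankel.
Variables (R : comNzRingType) (c : nat -> R).
Implicit Types P Q : {poly R}.

Definition hankel n : 'M[R]_n := \matrix_(i, j) c (i + j)%N.

(** The functional ['X^n |-> c n] evaluated at ['X^m * P]. *)
Definition moment m P : R := \sum_(i < size P) P`_i * c (m + i)%N.

Lemma momentE n m P : (size P <= n)%N ->
  moment m P = \sum_(i < n) P`_i * c (m + i)%N.
Proof.
move=> sPn; rewrite /moment (big_ord_widen n (fun i => P`_i * c (m + i)%N)) //.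
rewrite big_mkcond; apply: eq_bigr => i _; case: ltnP => // sPi.
by rewrite nth_default ?mul0r.
Qed.

Lemma momentD m P Q : moment m (P + Q) = moment m P + moment m Q.
Proof.
set n := maxn (size P) (size Q).
rewrite !(@momentE n) ?size_polyD ?leq_maxl ?leq_maxr // -big_split.
by apply: eq_bigr => i _; rewrite coefD mulrDl.
Qed.

Lemma momentZ m k P : moment m (k *: P) = k * moment m P.
Proof.
rewrite (@momentE (size P)) ?size_scale_leq // mulr_sumr.
by apply: eq_bigr => i _; rewrite coefZ mulrA.
Qed.

Lemma momentB m P Q : moment m (P - Q) = moment m P - moment m Q.
Proof. by rewrite momentD -scaleN1r momentZ mulN1r. Qed.

Lemma momentX m P : moment m ('X * P) = moment m.+1 P.
Proof.
rewrite (@momentE (size P).+1).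
  rewrite big_ord_recl coefXM mul0r add0r; apply: eq_bigr => i _.
  by rewrite coefXM /= /bump add1n addnS.
apply: leq_trans (size_polyMleq _ _) _.
by rewrite size_polyX.
Qed.

Lemma moment1 m : moment m 1 = c m.
Proof. by rewrite /moment size_poly1 big_ord1 coef1 mul1r addn0. Qed.

Lemma hankel_mul_coef n P i : (size P <= n)%N ->
  (hankel n *m \col_(j < n) P`_j) i 0 = moment i P.
Proof.
by move=> sP; rewrite mxE (momentE _ sP); apply: eq_bigr => j _; rewrite !mxE mulrC.
Qed.

Lemma hankel_cofactor00 n : cofactor (hankel n.+1) 0 0 = D2 c n.
Proof.
rewrite /cofactor expr0 mul1r; congr (\det _); apply/matrixP => i j.
by rewrite !mxE /= /bump !add1n addSn addnS addn2.
Qed.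

Lemma hankel_cofactor_max n :
  cofactor (hankel n.+1) ord_max ord_max = \det (hankel n).
Proof.
rewrite /cofactor addnn -signr_odd odd_double mul1r; congr (\det _).
by apply/matrixP => i j; rewrite !mxE !lift_max.
Qed.

(** The image of the coefficient vector of [P] is supported in the last coordinate; Cramer's rule is
    read at the leading coefficient. *)
Lemma det_hankelS n P : (size P <= n.+1)%N -> P`_n = 1 ->
    (forall m, (m < n)%N -> moment m P = 0) ->
  \det (hankel n.+1) = moment n P * \det (hankel n).
Proof.
move=> sP Pn P0; rewrite -(hankel_cofactor_max n).
rewrite -(@det_mul_coord _ _ _ (\col_j P`_j)) ?mxE /= ?Pn ?mulr1 //.
apply/matrixP => i k; rewrite ord1 hankel_mul_coef // !mxE eqxx andbT.
have [->|ni] := eqVneq i ord_max; first by rewrite mulr1.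
by rewrite mulr0 P0 // ltn_neqAle ni -ltnS ltn_ord.
Qed.

(** The extra orthogonality makes the matrix of size [n.+1] singular, so Cramer's rule is used
    twice: on the last row at size [n.+2], then on the resulting minor. *)
Lemma det_hankelSS n P : (size P <= n.+1)%N -> P`_n = 1 ->
    (forall m, (m <= n)%N -> moment m P = 0) ->
  \det (hankel n.+2) = - moment n.+1 P ^+ 2 * \det (hankel n).
Proof.
move=> sP Pn P0.
pose j : 'I_n.+2 := widen_ord (leqnSn n.+1) ord_max.
(* After transposition the minor keeps the rows [0, ..., n - 1, n.+1], and [P] is annihilated by all
   but the last. *)
pose B : 'M[R]_n.+1 := (row' ord_max (col' j (hankel n.+2)))^T.
have detB : \det B = moment n.+1 P * \det (hankel n).
  have -> : \det (hankel n) = cofactor B ord_max ord_max.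
    rewrite /cofactor addnn -signr_odd odd_double mul1r; congr (\det _).
    apply/matrixP => x y; rewrite !mxE /= /bump; congr (c _).
    by have := ltn_ord x; have := ltn_ord y; lia.
  rewrite -(@det_mul_coord _ _ _ (\col_j P`_j)) ?mxE /= ?Pn ?mulr1 //.
  apply/matrixP => x y; rewrite ord1.
  transitivity (moment (bump n x) P).
    rewrite mxE (momentE _ sP); apply: eq_bigr => l _.
    by rewrite !mxE lift_max mulrC addnC.
  rewrite !mxE eqxx andbT /bump.
  have [->|nx] := eqVneq x ord_max; first by rewrite /= leqnn mulr1.
  have xn : (x < n)%N by rewrite ltn_neqAle nx -ltnS ltn_ord.
  by rewrite leqNgt xn mulr0 P0 // ltnW.
have : \det (hankel n.+2) * P`_n = moment n.+1 P * cofactor (hankel n.+2) ord_max j.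
  rewrite -(@det_mul_coord _ _ _ (\col_j P`_j)) ?mxE //.
  apply/matrixP => i k; rewrite ord1 hankel_mul_coef ?(leqW sP) // !mxE eqxx andbT.
  have [->|ni] := eqVneq i ord_max; first by rewrite mulr1.
  by rewrite mulr0 P0 // -ltnS ltn_neqAle ni -ltnS ltn_ord.
rewrite Pn mulr1 => ->; rewrite /cofactor /= -det_tr -/B detB.
by rewrite addSn addnn exprS -signr_odd odd_double; ring.
Qed.

Lemma D2_of_kernel n P : (size P <= n.+1)%N ->
    (forall m, (0 < m <= n)%N -> moment m P = 0) ->
  moment 0 P * D2 c n = \det (hankel n.+1) * P`_0.
Proof.
move=> sP P0; rewrite -hankel_cofactor00.
rewrite -(@det_mul_coord _ _ _ (\col_j P`_j)) ?mxE //.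
apply/matrixP => i k; rewrite ord1 hankel_mul_coef // !mxE eqxx andbT.
have [->|ni] := eqVneq i 0; first by rewrite mulr1.
by rewrite mulr0 P0 // lt0n ni -ltnS ltn_ord.
Qed.

(** A kernel vector makes the cofactors along a row proportional to its coordinates; with the
    symmetry of the Hankel matrix this leads from [(0, 0)] through [(0, n)] to [(n, n)]. *)
Lemma D2_of_ker n P : (size P <= n.+1)%N -> P`_n = 1 ->
    (forall m, (m <= n)%N -> moment m P = 0) ->
  D2 c n = P`_0 ^+ 2 * \det (hankel n).
Proof.
move=> sP Pn P0; set H := hankel n.+1.
have HP : H *m (\col_j P`_j) = 0.
  apply/matrixP => i k; rewrite ord1 hankel_mul_coef // mxE P0 //.
  by rewrite -ltnS ltn_ord.
have tH : cofactor H 0 ord_max = cofactor H ord_max 0.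
  rewrite -cofactor_tr; congr cofactor.
  by apply/matrixP => i j; rewrite !mxE addnC.
have /= := cofactor_ker 0 0 ord_max HP; rewrite !mxE /= Pn mulr1.
rewrite hankel_cofactor00 tH => ->.
have /= := cofactor_ker ord_max 0 ord_max HP; rewrite !mxE /= Pn mulr1 => ->.
by rewrite hankel_cofactor_max; ring.
Qed.

End Hankel.

(** * Formal power series *)

Section Fps.
Variable R : comNzRingType.
Implicit Types (g h : fps R) (k : R).

Lemma fpsC_is_zmod_morphism : zmod_morphism (@fpsC R).
Proof. by move=> x y; apply: fpsP => -[|n] //=; rewrite subr0. Qed.

Lemma coef_fpsCM k g n : (fpsC k * g) n = k * g n.
Proof.
rewrite -[LHS]/(\sum_(i < n.+1) _) big_ord_recl /= subn0.
by rewrite big1 ?addr0 // => i _; rewrite mul0r.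
Qed.

Lemma fpsC_is_monoid_morphism : monoid_morphism (@fpsC R).
Proof.
split=> // x y; apply: fpsP => n; rewrite coef_fpsCM /=.
by case: n => [|n] //=; rewrite mulr0.
Qed.

HB.instance Definition _ :=
  GRing.isZmodMorphism.Build R (fps R) (@fpsC R) fpsC_is_zmod_morphism.
HB.instance Definition _ :=
  GRing.isMonoidMorphism.Build R (fps R) (@fpsC R) fpsC_is_monoid_morphism.

Lemma coef_fpsD g h n : (g + h) n = g n + h n. Proof. by []. Qed.

Lemma coef0_fpsM g h : (g * h) 0%N = g 0%N * h 0%N.
Proof. by rewrite -[LHS]/(\sum_(i < 1) _) big_ord1. Qed.

Lemma coef0_fpsX g n : g 0%N = 1 -> (g ^+ n) 0%N = 1.
Proof. by move=> g1; elim: n => // n IH; rewrite exprS coef0_fpsM g1 IH mul1r. Qed.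

Lemma coef_fpsXM g n : (fpsX * g) n = if n is m.+1 then g m else 0.
Proof.
rewrite -[LHS]/(\sum_(i < n.+1) _) big_ord_recl /= mul0r add0r.
case: n => [|n]; first by rewrite big_ord0.
rewrite big_ord_recl /= subSS subn0 mul1r big1 ?addr0 // => i _.
by rewrite mul0r.
Qed.

Lemma coef_fpsXnM g d n :
  (fpsX ^+ d * g) n = if (n < d)%N then 0 else g (n - d)%N.
Proof.
elim: d n => [|d IH] n; first by rewrite expr0 mul1r subn0.
by rewrite exprS -mulrA coef_fpsXM; case: n => [|n] //; rewrite IH.
Qed.

Lemma fpsXM_inj g h : fpsX * g = fpsX * h -> g = h.
Proof.
by move=> gh; apply: fpsP => n; have := coef_fpsXM g n.+1; rewrite gh coef_fpsXM.
Qed.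

End Fps.

(** * The orthogonal polynomials *)

Section OrthogonalPolynomials.
Variables (R : comNzRingType) (a b t : R).

(* [(opoly n).1] and [(opoly n).2] are the denominators, of degrees [3 n] and
   [3 n + 1], of the convergents of the continued fraction of [f / (1 - t z f)]
   in [x = 1 / z]; there is no orthogonal polynomial of degree [3 n + 2]. *)
Fixpoint opoly n : {poly R} * {poly R} :=
  if n is m.+1 then
    let u := 'X * ('X * (opoly m).2) - a *: ('X * (opoly m).2)
      - b *: (opoly m).1 in
    (u, 'X * u - a *: u - b *: (opoly m).2)
  else (1, 'X * 1 - (a + t) *: 1).

Lemma opoly1S n : (opoly n.+1).1 =
  'X * ('X * (opoly n).2) - a *: ('X * (opoly n).2) - b *: (opoly n).1.
Proof. by []. Qed.

Lemma opoly2S n : (opoly n.+1).2 =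
  'X * (opoly n.+1).1 - a *: (opoly n.+1).1 - b *: (opoly n).2.
Proof. by []. Qed.

Definition monic_deg d (P : {poly R}) := (size P <= d.+1)%N /\ P`_d = 1.

Lemma opoly_monic_deg n :
  monic_deg (3 * n) (opoly n).1 /\ monic_deg (3 * n).+1 (opoly n).2.
Proof.
elim: n => [|n [[su u1] [sv v1]]].
  split; split; rewrite ?size_poly1 ?coef1 //.
    apply/leq_sizeP => -[|[|j]] // _.
    by rewrite coefB coefZ coefXM !coef1 mulr0 subrr.
  by rewrite coefB coefZ coefXM !coef1 mulr0 subr0.
move/leq_sizeP: su => su; move/leq_sizeP: sv => sv.
have -> : (3 * n.+1 = (3 * n).+3)%N by lia.
have U : monic_deg (3 * n).+3 (opoly n.+1).1.
  split; last first.
    rewrite opoly1S !coefB !coefZ !coefXM /= v1.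
    by rewrite su ?sv ?mulr0 ?subr0 //; lia.
  apply/leq_sizeP => -[|[|j]] // lej; rewrite opoly1S !coefB !coefZ !coefXM /=.
  by rewrite su ?sv ?mulr0 ?subr0 //; lia.
split=> //; case: U => /leq_sizeP su' u1'; split; last first.
  rewrite opoly2S !coefB !coefZ !coefXM /= u1'.
  by rewrite su' ?sv ?mulr0 ?subr0 //; lia.
apply/leq_sizeP => -[|j] // lej; rewrite opoly2S !coefB !coefZ !coefXM.
by rewrite !su' ?sv ?mulr0 ?subr0 //; lia.
Qed.

(** Chosen so that [(opoly n).2 + tau n *: (opoly n).1] vanishes at [0]; it grows by [a] at each
    period. *)
Let tau n : R := t + n.+1%:R * a.

Lemma opoly1_coef0 n : (opoly n).1`_0 = (- b) ^+ n.
Proof.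
elim: n => [|n IH]; first by rewrite coef1.
by rewrite opoly1S !coefB !coefZ !coefXM IH exprS /=; ring.
Qed.

Lemma opoly2_coef0 n : (opoly n).2`_0 = - (- b) ^+ n * tau n.
Proof.
elim: n => [|n IH]; first by rewrite coefB coefZ coefXM coef1 /= /tau; ring.
rewrite opoly2S !coefB !coefZ !coefXM IH opoly1_coef0 exprS /tau /=.
by rewrite -[n.+2%:R]natr1; ring.
Qed.

(* Reproducing kernels at [0]: for [P] of degree at most [3 n], the functional
   sends [kpoly n * P] to [(- b) ^+ n * P`_0]; likewise for [kpoly_next n] with
   degree at most [3 n + 2] and factor [(- b) ^+ n.+1]. *)
Fixpoint kpoly n : {poly R} :=
  if n is m.+1 then
    (opoly m.+1).1
      + (tau m *: ('X * (opoly m).2 - a *: (opoly m).2) - b *: kpoly m)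
  else 1.

Definition kpoly_next n : {poly R} :=
  tau n *: ('X * (opoly n).2 - a *: (opoly n).2) - b *: kpoly n.

Lemma kpolyS n : kpoly n.+1 = (opoly n.+1).1 + kpoly_next n.
Proof. by []. Qed.

(* Christoffel-Darboux *)
Lemma mulX_kpoly n : 'X * kpoly n = (opoly n).2 + tau n *: (opoly n).1.
Proof.
elim: n => [|n IH]; first by rewrite /= /tau -!mul_polyC; ring.
have tauS : tau n.+1 = tau n + a by rewrite /tau -[n.+2%:R]natr1; ring.
rewrite kpolyS /kpoly_next.
(* Regrouped so that ['X * kpoly n] appears for the induction hypothesis. *)
transitivity ('X * (opoly n.+1).1
    + tau n *: ('X * ('X * (opoly n).2 - a *: (opoly n).2))
    - b *: ('X * kpoly n)).
  move: (opoly n.+1).1 (opoly n).2 (kpoly n) (tau n) => ? ? ? ?.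
  by rewrite -!mul_polyC; ring.
rewrite IH opoly2S tauS opoly1S.
move: (opoly n).1 (opoly n).2 (tau n) => ? ? ?.
by rewrite -!mul_polyC rmorphD /=; ring.
Qed.

Lemma mulX_kpoly_next n :
  'X * kpoly_next n = tau n *: (opoly n.+1).1 - b *: (opoly n).2.
Proof.
rewrite /kpoly_next opoly1S.
transitivity (tau n *: ('X * ('X * (opoly n).2 - a *: (opoly n).2))
    - b *: ('X * kpoly n)).
  by move: (opoly n).2 (kpoly n) (tau n) => ? ? ?; rewrite -!mul_polyC; ring.
rewrite mulX_kpoly.
by move: (opoly n).1 (opoly n).2 (tau n) => ? ? ?; rewrite -!mul_polyC; ring.
Qed.

Lemma size_kpoly_next n : (size (kpoly n) <= (3 * n).+1)%N ->
  (size (kpoly_next n) <= (3 * n).+3)%N.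
Proof.
move=> /leq_sizeP sk; have [_ [/leq_sizeP sv _]] := opoly_monic_deg n.
apply/leq_sizeP => -[|j] // lej; rewrite /kpoly_next coefB !coefZ coefB coefZ coefXM.
by rewrite sk ?sv ?mulr0 ?subr0 ?mulr0 //; lia.
Qed.

Lemma size_kpoly n : (size (kpoly n) <= (3 * n).+1)%N.
Proof.
elim: n => [|n IH]; first by rewrite size_poly1.
have [[su _] _] := opoly_monic_deg n.+1.
rewrite kpolyS (leq_trans (size_polyD _ _)) // geq_max su.
by rewrite (leq_trans (size_kpoly_next IH)) //; lia.
Qed.

(** Up to the factor [- (- b) ^+ n], the recursion adds [a * tau n ^+ 2 - b] at each step. The [b]
    on the left avoids an exponent [n - 1]. *)
Lemma kpoly_coef0 n : b * (kpoly n)`_0 =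
  - (- b) ^+ n * (a * (\sum_(0 <= i < n) tau i ^+ 2) - n.+1%:R * b).
Proof.
elim: n => [|n IH]; first by rewrite coef1 big_nil /=; ring.
rewrite kpolyS coefD opoly1_coef0 /kpoly_next coefB !coefZ coefB coefZ coefXM /=.
rewrite opoly2_coef0 IH big_nat_recr //= -[n.+2%:R]natr1 exprS; ring.
Qed.

Lemma kpoly_next_coef0 n : b * (kpoly_next n)`_0 =
  (- b) ^+ n * b * (a * (\sum_(0 <= i < n.+1) tau i ^+ 2) - n.+1%:R * b).
Proof.
rewrite /kpoly_next coefB !coefZ coefB coefZ coefXM /=.
by rewrite opoly2_coef0 kpoly_coef0 big_nat_recr //=; ring.
Qed.

Lemma sum_tau n : a * (\sum_(0 <= i < n) tau i ^+ 2) =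
  a ^+ 3 * (\sum_(0 <= i < n.+1) i%:R ^+ 2) + n%:R * a * t * (t + n.+1%:R * a).
Proof.
elim: n => [|n IH]; first by rewrite big_nil big_nat1; ring.
rewrite big_nat_recr // big_nat_recr //= !mulrDr IH /tau.
by rewrite -[n.+2%:R]natr1 -[n.+1%:R]natr1; ring.
Qed.

End OrthogonalPolynomials.

(** * Orthogonality and the determinants *)

Section Determinants.
Variables (R : comNzRingType) (a b t : R) (f : fps R) (C : nat -> R).
Let F : fps R := Fps C.
Hypothesis hf : f = 1 + fpsC a * fpsX * f + fpsC b * fpsX ^+ 3 * f ^+ 2.
Hypothesis hF : F * (1 - fpsC t * fpsX * f) = f.

Let u n := (opoly a b t n).1.
Let v n := (opoly a b t n).2.
Let mseries (P : {poly R}) : fps R := Fps (moment C ^~ P).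
Let T n : fps R := F * (fpsC b ^+ 2 * fpsX ^+ 3 * f ^+ 2) ^+ n.

Let f0 : f 0%N = 1.
Proof.
rewrite hf !coef_fpsD -!mulrA !(coef_fpsCM, coef_fpsXM, coef_fpsXnM) /=.
by rewrite !mulr0 !addr0.
Qed.

(** The series [g] below is the inverse of [f]; [hF] is multiplied by it. *)
Let hF1 : F * (1 - fpsC (a + t) * fpsX - fpsC b * fpsX ^+ 3 * f) = 1.
Proof.
set g := 1 - fpsC a * fpsX - fpsC b * fpsX ^+ 3 * f.
have fg : f * g = 1 by rewrite /g mulrBr mulrBr mulr1 {1}hf; ring.
transitivity (F * (g - fpsC t * fpsX * (f * g))).
  by rewrite fg /g rmorphD /=; ring.
by rewrite -[RHS]fg -[in RHS]hF; ring.
Qed.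

Let F0 : F 0%N = 1.
Proof.
have := coef0_fpsM F (1 - fpsC t * fpsX * f); rewrite hF f0 => ->.
rewrite -[X in _ * X]/(1 - (fpsC t * fpsX * f) 0%N) -mulrA.
by rewrite coef_fpsCM coef_fpsXM mulr0 subr0 mulr1.
Qed.

Let mseriesB P Q : mseries (P - Q) = mseries P - mseries Q.
Proof. by apply: fpsP => m; apply: momentB. Qed.

Let mseriesZ k P : mseries (k *: P) = fpsC k * mseries P.
Proof. by apply: fpsP => m; rewrite coef_fpsCM; apply: momentZ. Qed.

Let mseriesX P : fpsX * mseries ('X * P) = mseries P - fpsC (moment C 0 P).
Proof.
apply: fpsP => m; rewrite coef_fpsXM.
case: m => [|m]; first by rewrite /= subrr.
by rewrite /= subr0 momentX.
Qed.

Let TS n : T n.+1 = fpsC b ^+ 2 * fpsX ^+ 3 * f ^+ 2 * T n.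
Proof. by rewrite /T exprS; ring. Qed.

Let coefT n m :
  T n m = if (m < 3 * n)%N then 0
          else b ^+ (2 * n) * (F * f ^+ (2 * n)) (m - 3 * n)%N.
Proof.
have -> : T n = fpsX ^+ (3 * n) * (fpsC (b ^+ (2 * n)) * (F * f ^+ (2 * n))).
  by rewrite /T rmorphXn /= !exprM !exprMn; ring.
by rewrite coef_fpsXnM coef_fpsCM.
Qed.

Let coefV n m : (fpsC b * fpsX ^+ 2 * f * T n) m =
  if (m < (3 * n).+2)%N then 0
  else b ^+ (2 * n).+1 * (F * f ^+ (2 * n).+1) (m - (3 * n).+2)%N.
Proof.
have -> : fpsC b * fpsX ^+ 2 * f * T n = fpsX ^+ (3 * n).+2 *
   (fpsC (b ^+ (2 * n).+1) * (F * f ^+ (2 * n).+1)).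
  rewrite /T rmorphXn /= (exprS _ (3 * n).+1) !(exprS _ (_ * _)).
  by rewrite !exprM !exprMn; ring.
by rewrite coef_fpsXnM coef_fpsCM.
Qed.

(** Since the initial moments vanish, multiplying a polynomial by ['X] divides its series exactly by
    [fpsX]; the recurrences of [opoly] then reduce to [hfz], the equation of [f]. *)
Lemma mseries_opoly n :
  mseries (u n) = T n /\ mseries (v n) = fpsC b * fpsX ^+ 2 * f * T n.
Proof.
have hfz : f - fpsC a * fpsX * f - 1 = fpsC b * fpsX ^+ 3 * f ^+ 2.
  by rewrite {1}hf; ring.
elim: n => [|n [Un Vn]].
  have U0 : mseries (u 0) = T 0.
    by apply: fpsP => m; rewrite /T expr0 mulr1 /= moment1.
  split=> //; apply: fpsXM_inj; rewrite /v /= mseriesB mulrBr mseriesX moment1.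
  rewrite -/(u 0) mseriesZ U0 /T expr0 mulr1 -[C 0%N]/(F 0%N) F0 rmorph1.
  by rewrite -[X in F - X - _]hF1; ring.
have v00 : moment C 0 (v n) = 0.
  by rewrite -[LHS]/(mseries (v n) 0%N) Vn coefV.
have v10 : moment C 0 ('X * v n) = 0.
  by rewrite momentX -[LHS]/(mseries (v n) 1%N) Vn coefV.
have e1 : fpsX * mseries ('X * v n) = mseries (v n).
  by rewrite mseriesX v00 raddf0 subr0.
have e2 : fpsX * mseries ('X * ('X * v n)) = mseries ('X * v n).
  by rewrite mseriesX v10 raddf0 subr0.
have US : mseries (u n.+1) = T n.+1.
  (* Two factors [fpsX] compensate the two factors ['X] in [opoly1S]. *)
  apply: fpsXM_inj; apply: fpsXM_inj; rewrite /u opoly1S -/(u n) -/(v n).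
  rewrite !mseriesB !mseriesZ TS.
  transitivity (fpsX * (fpsX * mseries ('X * ('X * v n)))
    - fpsC a * fpsX * (fpsX * mseries ('X * v n))
    - fpsC b * fpsX ^+ 2 * mseries (u n)).
    by move: (mseries _) (mseries _) (mseries _) => ? ? ?; ring.
  rewrite e2 e1 Un Vn.
  transitivity (fpsC b * fpsX ^+ 2 * T n * (f - fpsC a * fpsX * f - 1)); first by ring.
  by rewrite hfz; ring.
split=> //; apply: fpsXM_inj; rewrite /v opoly2S -/(u n.+1) -/(v n).
have u00 : moment C 0 (u n.+1) = 0.
  by rewrite -[LHS]/(mseries (u n.+1) 0%N) US coefT mulnS.
have e3 : fpsX * mseries ('X * u n.+1) = mseries (u n.+1).
  by rewrite mseriesX u00 raddf0 subr0.
rewrite !mseriesB !mseriesZ.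
transitivity (fpsX * mseries ('X * u n.+1) - fpsC a * fpsX * mseries (u n.+1)
    - fpsC b * fpsX * mseries (v n)).
  by move: (mseries _) (mseries _) (mseries _) => ? ? ?; ring.
rewrite e3 US Vn TS.
transitivity (fpsC b ^+ 2 * fpsX ^+ 3 * f * T n * (f - fpsC a * fpsX * f - 1)).
  by ring.
by rewrite hfz; ring.
Qed.

Lemma moment_opoly1 n m : (m < 3 * n)%N -> moment C m (opoly a b t n).1 = 0.
Proof.
by move=> mn; rewrite -[LHS]/(mseries (u n) m) (mseries_opoly n).1 coefT mn.
Qed.

Lemma moment_opoly1_diag n : moment C (3 * n) (opoly a b t n).1 = b ^+ (2 * n).
Proof.
rewrite -[LHS]/(mseries (u n) _) (mseries_opoly n).1 coefT ltnn subnn.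
by rewrite coef0_fpsM coef0_fpsX // F0 !mulr1.
Qed.

Lemma moment_opoly2 n m : (m < (3 * n).+2)%N -> moment C m (opoly a b t n).2 = 0.
Proof.
by move=> mn; rewrite -[LHS]/(mseries (v n) m) (mseries_opoly n).2 coefV mn.
Qed.

Lemma moment_opoly2_next n : moment C (3 * n).+2 (opoly a b t n).2 = b ^+ (2 * n).+1.
Proof.
rewrite -[LHS]/(mseries (v n) _) (mseries_opoly n).2 coefV ltnn subnn.
by rewrite coef0_fpsM coef0_fpsX // F0 !mulr1.
Qed.

Lemma det_hankel1 n :
  \det (hankel C (3 * n).+1) = b ^+ (2 * n) * \det (hankel C (3 * n)).
Proof.
have [[su u1] _] := opoly_monic_deg a b t n.
by rewrite (det_hankelS su u1) ?moment_opoly1_diag // => m; apply: moment_opoly1.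
Qed.

(** The moments of [(opoly n).2] vanish up to index [3 * n + 1], one more than its degree requires,
    so the size [3 * n + 2] is skipped. *)
Lemma det_hankel3 n :
  \det (hankel C (3 * n).+3) =
    - b ^+ (2 * (2 * n).+1) * \det (hankel C (3 * n).+1).
Proof.
have [_ [sv v1]] := opoly_monic_deg a b t n.
rewrite (det_hankelSS sv v1); last by move=> m; apply: moment_opoly2.
by rewrite moment_opoly2_next -exprM mulnC.
Qed.

Lemma det_hankel_3n n :
  \det (hankel C (3 * n)) = (-1) ^+ n * b ^+ (3 * n ^ 2 - n).
Proof.
elim: n => [|n IH]; first by rewrite det_mx00 mul1r.
have -> : (3 * n.+1 = (3 * n).+3)%N by lia.
rewrite det_hankel3 det_hankel1 IH.
have -> : (3 * n.+1 ^ 2 - n.+1 = 2 * (2 * n).+1 + (2 * n + (3 * n ^ 2 - n)))%N by nia.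
by rewrite !exprD exprS; ring.
Qed.

Lemma det_hankel_3n1 n :
  \det (hankel C (3 * n).+1) = (-1) ^+ n * b ^+ (3 * n ^ 2 + n).
Proof.
rewrite det_hankel1 det_hankel_3n mulrCA -exprD.
by congr (_ * b ^+ _); nia.
Qed.

(** The [opoly] terms added at each period have zero moment, so the moment is only multiplied by
    [- b]. *)
Lemma moment0_kpoly n : moment C 0 (kpoly a b t n) = (- b) ^+ n.
Proof.
elim: n => [|n IH]; first by rewrite moment1 -[C 0%N]/(F 0%N) F0.
rewrite kpolyS momentD moment_opoly1 ?mulnS // /kpoly_next momentB !momentZ.
rewrite momentB momentZ momentX !moment_opoly2 // IH exprS.
by ring.
Qed.

Lemma moment0_kpoly_next n : moment C 0 (kpoly_next a b t n) = (- b) ^+ n.+1.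
Proof.
rewrite /kpoly_next momentB !momentZ momentB momentZ momentX.
by rewrite !moment_opoly2 // moment0_kpoly exprS; ring.
Qed.

Lemma D2_kpoly n : (- b) ^+ n * D2 C (3 * n) =
  \det (hankel C (3 * n).+1) * (kpoly a b t n)`_0.
Proof.
rewrite -moment0_kpoly; apply: D2_of_kernel; first exact: size_kpoly.
move=> [|m] // /andP[_ mn].
(* One factor ['X] is moved into the polynomial, where [mulX_kpoly] leaves only terms orthogonal to
   ['X^m]. *)
rewrite -momentX mulX_kpoly momentD momentZ moment_opoly1 //.
by rewrite moment_opoly2 ?mulr0 ?addr0 //; lia.
Qed.

Lemma D2_kpoly_next n : (- b) ^+ n.+1 * D2 C (3 * n).+2 =
  \det (hankel C (3 * n).+3) * (kpoly_next a b t n)`_0.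
Proof.
rewrite -moment0_kpoly_next; apply: D2_of_kernel.
  exact/size_kpoly_next/size_kpoly.
move=> [|m] // /andP[_ mn].
rewrite -momentX mulX_kpoly_next momentB !momentZ moment_opoly1; last by lia.
by rewrite moment_opoly2 ?mulr0 ?subr0 //; lia.
Qed.

Lemma D2_3n1 n : D2 C (3 * n).+1 =
  (-1) ^+ n * (t + n.+1%:R * a) ^+ 2 * b ^+ (3 * n ^ 2 + 3 * n).
Proof.
have [_ [sv v1]] := opoly_monic_deg a b t n.
rewrite (D2_of_ker sv v1); last by move=> m mn; apply: moment_opoly2.
rewrite opoly2_coef0 det_hankel_3n1.
have -> : (3 * n ^ 2 + 3 * n = n * 2 + (3 * n ^ 2 + n))%N by lia.
rewrite [b ^+ (n * 2 + _)]exprD exprM (exprNn b).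
(* The sign of [(- b) ^+ n] disappears on squaring. *)
have := sqrr_sign R n; set e := (-1) ^+ n; move: (e) => {}e e2.
transitivity (e ^+ 2 * (e * (t + n.+1%:R * a) ^+ 2
    * ((b ^+ n) ^+ 2 * b ^+ (3 * n ^ 2 + n)))); first by ring.
by rewrite e2 mul1r.
Qed.

(** All moments of ['X - (a + t)] vanish when [b = 0], which gives a relation between the first two
    columns. *)
Lemma D2_b0 n : b = 0 -> (1 < n)%N -> D2 C n = 0.
Proof.
move=> b0; case: n => [|[|n]] // _.
have [_ [sv v1]] := opoly_monic_deg a b t 0.
have m0 m : moment C m (v 0) = 0.
  rewrite -[LHS]/(mseries (v 0) m) (mseries_opoly 0).2 b0 raddf0.
  by rewrite -!mulrA mul0r.
rewrite /D2; set A := \matrix_(i, j) _.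
have /= := @det_mul_coord _ _ A (\col_j (v 0)`_j) 0 0 1; rewrite mxE v1 mulr1 mul0r.
apply; rewrite scale0r; apply/matrixP => i j; rewrite !mxE -[RHS](m0 (i + 2)%N).
rewrite (@momentE _ _ n.+2) ?(leq_trans sv) //.
by apply: eq_bigr => k _; rewrite !mxE mulrC addnAC.
Qed.

End Determinants.

(** At [n = 0] the first exponent is [-1], hence the integer power and the condition on [b]: the
    inverse of [0] is [0] by convention, whereas the empty determinant is [1] for every [b]. *)
Theorem theorem6p5 (R : realType) (a b t : R[i])
    (f : fps R[i])
    (hf : f = 1 + fpsC a * fpsX * f + fpsC b * fpsX ^+ 3 * f ^+ 2)
    (C : nat -> R[i])
    (hC : Fps C = f / (1 - fpsC t * fpsX * f)) :
  [/\ forall n : nat, (b != 0) || (0 < n)%N ->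
        D2 C (3 * n)%N =
          (-1) ^+ n.+1 * b ^ (3 * n%:Z ^+ 2 + n%:Z - 1)
          * (a ^+ 3 * (\sum_(0 <= i < n.+1) i%:R ^+ 2) - n.+1%:R * b
             + n%:R * a * t * (t + n.+1%:R * a)),
      D2 C 0%N = 1,
      forall n : nat,
        D2 C (3 * n + 1)%N =
          (-1) ^+ n * (t + n.+1%:R * a) ^+ 2 * b ^+ (3 * n ^ 2 + 3 * n)%N
    & forall n : nat, (1 <= n)%N ->
        D2 C (3 * n - 1)%N =
          (-1) ^+ (n - 1)%N * b ^+ (3 * n ^ 2 - n - 1)%N
          * (a ^+ 3 * (\sum_(0 <= i < n.+1) i%:R ^+ 2) - n%:R * b
             + n%:R * a * t * (t + n.+1%:R * a))].
Proof.
have hF : Fps C * (1 - fpsC t * fpsX * f) = f.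
  (* The denominator is invertible because its constant coefficient is [1]. *)
  rewrite hC divrK // -[X in is_true X]/((1 - fpsC t * fpsX * f) 0%N \is a GRing.unit).
  rewrite -[X in X \is a _]/(1 - (fpsC t * fpsX * f) 0%N) -mulrA.
  by rewrite coef_fpsCM coef_fpsXM mulr0 subr0 unitr1.
(* Used with [k = n.+1] for the first formula and [k = n] for the last. *)
have sumE n k : a ^+ 3 * (\sum_(0 <= i < n.+1) i%:R ^+ 2) - k%:R * b
      + n%:R * a * t * (t + n.+1%:R * a)
    = a * (\sum_(0 <= i < n) (t + i.+1%:R * a) ^+ 2) - k%:R * b.
  by rewrite sum_tau addrAC.
split.
- move=> n hn; rewrite sumE.
  have [b0|bn0] := eqVneq b 0.
    case: n hn => [|n _]; first by rewrite b0 eqxx.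
    rewrite (D2_b0 hf hF) //; last by lia.
    have -> : 3 * n.+1%:Z ^+ 2 + n.+1%:Z - 1 = (3 * n.+1 ^ 2 + n)%N by lia.
    by rewrite b0 -exprnP expr0n mulr0 mul0r.
  (* The factor [b] comes from [kpoly_coef0], and [(- b) ^+ n] is the moment of the kernel in
     [D2_kpoly]. *)
  apply: (mulfI bn0); apply: (mulfI (expf_neq0 n (_ : - b != 0))).
    by rewrite oppr_eq0.
  rewrite mulrCA (D2_kpoly hf hF) mulrCA kpoly_coef0 (det_hankel_3n1 hf hF).
  rewrite expfzDr // -[b ^ (-1)]/(b^-1).
  have -> : 3 * n%:Z ^+ 2 + n%:Z = (3 * n ^ 2 + n)%N by lia.
  by rewrite -exprnP [(-1) ^+ n.+1]exprS; field.
- exact: det_mx00.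
- by move=> n; rewrite addn1 (D2_3n1 hf hF).
- case=> // n _; rewrite sumE.
  (* With [n] shifted to [n.+1], this is the size handled by [kpoly_next n]. *)
  have -> : (3 * n.+1 - 1 = (3 * n).+2)%N by lia.
  rewrite subn1 /=.
  have [b0|bn0] := eqVneq b 0.
    rewrite (D2_b0 hf hF) // b0 expr0n.
    have /negPf -> : (3 * n.+1 ^ 2 - n.+1 - 1 != 0)%N by nia.
    by rewrite mulr0 mul0r.
  apply: (mulfI bn0); apply: (mulfI (expf_neq0 n.+1 (_ : - b != 0))).
    by rewrite oppr_eq0.
  rewrite mulrCA (D2_kpoly_next hf hF) mulrCA kpoly_next_coef0.
  have -> : ((3 * n).+3 = 3 * n.+1)%N by lia.
  rewrite (det_hankel_3n hf hF).
  set m := (3 * n.+1 ^ 2 - n.+1 - 1)%N.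
  have -> : (3 * n.+1 ^ 2 - n.+1 = m.+1)%N by rewrite /m; nia.
  by rewrite !exprS; ring.
Qed.
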